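(* Let $d \geq 7$ and $k \geq 1$ be integers. Then Player $A$ has a winning strategy in the game $Z(n,d)$ for every $n$ such that: (1) if $d$ is even, $n \in \{kd-1,\ (k+1)d+1,\ (k+3)d-3\}$; (2) if $d$ is odd, $n \in \{(2k-1)d-2,\ (2k-1)d,\ 2kd-1,\ 2kd+1,\ (2k+1)d+2,\ 2(k+1)d-3\}$.
   Context: For integers $n \geq 4$ and $d \geq 2$, $Z(n,d)$ is the following two-player game. Initially the board contains the numbers $1,2,\dots,n$. Players $A$ and $B$ alternately cross out (remove) one number from the board, with $A$ moving first, until exactly two numbers remain. If the sum of the two remaining numbers is divisible by $d$, $A$ wins; otherwise $B$ wins. A player has a winning strategy if that player can force a win regardless of the opponent's moves. *)

(* Defs.v *)
From mathcomp Require Import all_boot.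
Set Implicit Arguments.
Unset Strict Implicit.
Unset Printing Implicit Defensive.

Inductive player := PlayerA | PlayerB.

(* A history is the list of the numbers crossed out so far, oldest first. *)
Definition board (n : nat) (h : seq nat) : seq nat :=
  [seq x <- iota 1 n | x \notin h].

Definition legal_history (n : nat) (h : seq nat) : Prop :=
  [/\ uniq h, {subset h <= iota 1 n} & size h <= n - 2].

Definition to_move (h : seq nat) : player :=
  if odd (size h) then PlayerB else PlayerA.

Definition game_over (n : nat) (h : seq nat) : Prop := size (board n h) = 2.

(* Meaningful only when the game is over: the sum then has two terms. *)
Definition winner (n d : nat) (h : seq nat) : player :=
  if d %| sumn (board n h) then PlayerA else PlayerB.

(* A strategy prescribes the number to cross out after each history. *)
Definition strategy := seq nat -> nat.

Definition follows (p : player) (s : strategy) (h : seq nat) : Prop :=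
  forall i, i < size h -> to_move (take i h) = p -> nth 0 h i = s (take i h).

Definition legal_strategy (n : nat) (p : player) (s : strategy) : Prop :=
  forall h, legal_history n h -> follows p s h -> ~ game_over n h ->
    to_move h = p -> s h \in board n h.

Definition winning_strategy (n d : nat) (p : player) (s : strategy) : Prop :=
  legal_strategy n p s /\
  forall h, legal_history n h -> follows p s h -> game_over n h ->
    winner n d h = p.

Definition has_winning_strategy (n d : nat) (p : player) : Prop :=
  exists s : strategy, winning_strategy n d p s.

(* Main.v *)
Require Import Defs.
From mathcomp Require Import all_boot zify.

(* After its first move A aims at one of two kinds of boards. In the first, the
   numbers are paired off with all pair sums divisible by d, and A always
   deletes the partner of the number just deleted. In the second, such a
   pairing covers all numbers but four, of which three have pairwise sums
   divisible by d: they and the fourth number are left alone until B touches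
   one of them, and A can then restore a pairing. The pairing is x <-> M - x
   for a multiple M of d close to n (up to one pair {M/2, M}), and the three
   special numbers are all congruent to 0, or all congruent to d/2, modulo d. *)

Set Implicit Arguments.
Unset Strict Implicit.
Unset Printing Implicit Defensive.

Implicit Types (x y z n : nat) (S h : seq nat).

(** * Deletions, boards and histories *)

Definition del (x : nat) (S : seq nat) : seq nat := [seq z <- S | z != x].

Lemma mem_del x z S : (z \in del x S) = (z != x) && (z \in S).
Proof. by rewrite mem_filter. Qed.

Lemma del_uniq x S : uniq S -> uniq (del x S).
Proof. exact: filter_uniq. Qed.

Lemma size_del x S : uniq S -> x \in S -> size (del x S) = (size S).-1.
Proof.
by move=> uS xS; rewrite /del -(size_rem xS) (rem_filter x uS).
Qed.

Lemma board_rcons n h x : board n (rcons h x) = del x (board n h).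
Proof.
rewrite /del /board -filter_predI; apply: eq_filter => z /=.
by rewrite mem_rcons inE negb_or.
Qed.

Lemma board_uniq n h : uniq (board n h).
Proof. exact: filter_uniq (iota_uniq _ _). Qed.

Lemma legal_history_rcons n h x : legal_history n (rcons h x) ->
  [/\ legal_history n h, x \in board n h & size h < n - 2].
Proof.
case; rewrite rcons_uniq size_rcons => /andP[xh uh] sub sz.
split=> //; last first.
  by rewrite mem_filter xh; apply: sub; rewrite mem_rcons mem_head.
split=> //; last exact: ltnW.
by move=> z zh; apply: sub; rewrite mem_rcons inE zh orbT.
Qed.

Lemma size_board n h : legal_history n h -> size (board n h) = n - size h.
Proof.
elim/last_ind: h => [_|h x IH /legal_history_rcons[lh xb _]].
  by rewrite /board filter_predT size_iota subn0.
by rewrite board_rcons size_del ?board_uniq // IH // size_rcons; lia.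
Qed.

Lemma follows_rcons p s h x : follows p s (rcons h x) ->
  follows p s h /\ (to_move h = p -> x = s h).
Proof.
move=> fol; split=> [i ih tm|tm].
  have := fol i; rewrite size_rcons nth_rcons ih -cats1 takel_cat ?(ltnW ih) //.
  by apply=> //; apply: ltnW.
have := fol (size h); rewrite size_rcons nth_rcons ltnn eqxx.
by rewrite -cats1 take_size_cat //; apply.
Qed.

(** * Evaluating positions by backward induction *)

Section Divisor.

Variable d : nat.

(* Value of the position S for A when B is to move and m rounds
   (one move of B, then one of A) remain. *)
Fixpoint wins (m : nat) (S : seq nat) : bool :=
  if m is m'.+1 then
    all (fun x => has (fun y => wins m' (del y (del x S))) (del x S)) S
  else d %| sumn S.

(** A round removes two numbers and play stops at two, so a board of even size s has s/2 - 1 rounds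
    left. *)
Definition good (S : seq nat) : bool := wins (size S)./2.-1 S.

Definition good_reply (S : seq nat) : nat :=
  nth 0 S (find (fun y => good (del y S)) S).

Lemma good_replyP S : has (fun y => good (del y S)) S ->
  good_reply S \in S /\ good (del (good_reply S) S).
Proof.
move=> hS; split; first by apply: mem_nth; rewrite -has_find.
exact: (nth_find 0 hS).
Qed.

Lemma good_step S x : uniq S -> ~~ odd (size S) -> 2 < size S -> good S ->
  x \in S -> has (fun y => good (del y (del x S))) (del x S).
Proof.
move=> uS ev gt2; rewrite /good.
case E: (_./2.-1) => [|m]; first by lia.
move=> /= /allP winS xS; have /hasP[y yS wy] := winS x xS.
apply/hasP; exists y => //.
rewrite !size_del ?del_uniq //.
by have -> : (size S).-1.-1./2.-1 = m by lia.
Qed.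

(** A's strategy looks only at the current board and picks any number whose deletion leaves a good
    board. Since [n] is odd, A moves last. *)
Lemma good_first_move_wins n r : odd n -> 2 < n ->
  r \in iota 1 n -> good (del r (iota 1 n)) -> has_winning_strategy n d PlayerA.
Proof.
move=> on n3 rn gr; exists (fun h => good_reply (board n h)).
(* Invariant: when B is to move the board is good; when A is to move some deletion makes it good. At
   the empty history, [r] is such a deletion. *)
have inv h : legal_history n h ->
    follows PlayerA (fun h => good_reply (board n h)) h ->
    if odd (size h) then good (board n h)
    else has (fun y => good (del y (board n h))) (board n h).
  elim/last_ind: h => [_ _|h x IH].
    by apply/hasP; exists r; rewrite /board /= filter_predT.
  move=> lhx fhx; have [lh xb szh] := legal_history_rcons lhx.
  have [fh xE] := follows_rcons fhx; have := IH lh fh.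
  rewrite size_rcons /= board_rcons; move: xE; rewrite /to_move.
  have szb := size_board lh.
  case: ifP => oh /= xE.
    by move=> gb; apply: good_step => //; rewrite ?board_uniq // szb; lia.
  by move=> /good_replyP[_]; rewrite -xE.
split=> [h lh fh _ tm|h lh fh go].
  have := inv h lh fh; move: tm; rewrite /to_move.
  by case: ifP => // _ _ /good_replyP[].
have := inv h lh fh; have := size_board lh; rewrite go => szh.
(* The game ends after n - 2 moves, an odd number, so the invariant is in its B-to-move form; with
   no round left it is the divisibility itself. *)
have -> : odd (size h) by lia.
by rewrite /good go /winner /= => ->.
Qed.

(** * Pairings and triangles *)

Definition matching (f : nat -> nat) (S : seq nat) : Prop :=
  forall x, x \in S -> [/\ f x \in S, f x != x, f (f x) = x & d %| x + f x].

Lemma matching_del f S x : matching f S -> x \in S ->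
  matching f (del (f x) (del x S)).
Proof.
move=> mS xS z; rewrite !mem_del => /and3P[zfx zx zS].
have [fzS fzz ffz dz] := mS z zS; have [_ _ ffx _] := mS x xS.
split=> //; rewrite fzS andbT; apply/andP; split.
  by apply: contra_neq zx => e; rewrite -ffz e.
by apply: contra_neq zfx => <-.
Qed.

(** The old partner function may take any values at [b] and [c], so it is overridden there;
    elsewhere it stays inside [S'] and never meets them. *)
Lemma matching_add_pair f S S' b c : matching f S' -> b \notin S' ->
  c \notin S' -> b != c -> d %| b + c ->
  S =i b :: c :: S' ->
  matching (fun x => if x == b then c else if x == c then b else f x) S.
Proof.
move=> mS' bS cS bc dbc eS z; rewrite eS !inE => /or3P[/eqP->|/eqP->|zS].
- by rewrite eqxx (eq_sym c) (negPf bc) eqxx eS !inE eqxx orbT.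
- by rewrite eqxx (eq_sym c) (negPf bc) eqxx eS !inE eqxx addnC.
have old w : w \in S' -> (w == b = false) * (w == c = false).
  by move=> wS; split; apply: contraTF wS => /eqP->.
have [fzS fzz ffz dz] := mS' z zS.
by rewrite !(old z zS) !(old (f z) fzS) eS !inE fzS !orbT.
Qed.

(** Answering x by [f x] removes a whole pair, so the last two numbers are partners. *)
Lemma matching_good f S : uniq S -> ~~ odd (size S) -> 1 < size S ->
  matching f S -> good S.
Proof.
move: {-1}(_./2.-1) (erefl (size S)./2.-1) => m; rewrite /good => szm.
rewrite szm; elim: m S szm => [|m IH] S szm uS ev sz mS.
  case: S szm uS ev sz mS => [|x [|y [|? [|? ?]]]] //= _ /andP[xy _] _ _ mS.
  have [fx fxx _] := mS x (mem_head _ _).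
  by move: fx; rewrite !inE (negPf fxx) /= addn0 => /eqP->.
apply/allP => x xS; have [fxS fxx _ _] := mS x xS.
have fxD : f x \in del x S by rewrite mem_del fxx.
have szD : size (del (f x) (del x S)) = (size S).-2.
  by rewrite !size_del ?del_uniq.
apply/hasP; exists (f x) => //; apply: IH; rewrite ?szD ?del_uniq //; try lia.
exact: matching_del.
Qed.

(* If B breaks the triangle {a, b, c}, A deletes e; if B deletes e, A breaks
   the triangle: a matching is left in both cases. *)
Definition triangular (f : nat -> nat) (a b c e : nat) (S : seq nat) : Prop :=
  [/\ uniq [:: a; b; c; e], {subset [:: a; b; c; e] <= S},
      [/\ d %| a + b, d %| a + c & d %| b + c]
    & matching f [seq z <- S | z \notin [:: a; b; c; e]]].

(** The three vertices play the same role; by rotation only the first one has to be treated. *)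
Lemma triangular_rot f a b c e S :
  triangular f a b c e S -> triangular f b c a e S.
Proof.
case=> u sub [dab dac dbc] mS.
have E : [:: b; c; a; e] =i [:: a; b; c; e].
  by move=> z; rewrite !inE; case: (z == a); case: (z == b); case: (z == c).
split.
- by rewrite (uniq_size_uniq u) // => z; rewrite E.
- by move=> z; rewrite E; apply: sub.
- by rewrite (addnC b a) (addnC c a).
- by rewrite (eq_filter (a2 := fun z => z \notin [:: a; b; c; e])) // => z;
    rewrite E.
Qed.

(** Once [a] and [e] are gone, [b] and [c] become partners. The two orders of deletion are B taking
    [e] first and B taking [a] first. *)
Lemma triangular_break f a b c e S : triangular f a b c e S ->
  exists g, matching g (del a (del e S)) /\ matching g (del e (del a S)).
Proof.
case=> u sub [dab dac dbc] mS.
exists (fun x => if x == b then c else if x == c then b else f x).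
have bS : b \in S by apply: sub; rewrite !inE eqxx !orbT.
have cS : c \in S by apply: sub; rewrite !inE eqxx !orbT.
move: u; rewrite /= !inE !negb_or andbT.
case/and3P=> /and3P[ab ac ae] /andP[bc be] ce.
have E z : [&& z != a, z != e & z \in S] =
    (z \in b :: c :: [seq z <- S | z \notin [:: a; b; c; e]]).
  rewrite !inE mem_filter !inE !negb_or.
  have [->|zb] := eqVneq z b; first by rewrite bS eq_sym ab be.
  have [->|zc] := eqVneq z c; first by rewrite cS eq_sym ac ce.
  by rewrite /= andbA.
by split; apply: (matching_add_pair mS) => //;
  rewrite ?mem_filter ?inE ?eqxx ?orbT // => z; rewrite !mem_del -E // andbCA.
Qed.

Lemma triangular_good f a b c e S : uniq S -> ~~ odd (size S) ->
  triangular f a b c e S -> good S.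
Proof.
move: {-1}(_./2.-1) (erefl (size S)./2.-1) => m; rewrite /good => szm.
rewrite szm; elim: m S szm => [|m IH] S szm uS ev tS.
  (* With no round left at most two numbers remain, too few for the four special ones. *)
  case: tS => u sub _ _; have := uniq_leq_size u sub.
  by rewrite /=; lia.
have s4 : 4 <= size S by case: tS => u sub _ _; apply: (uniq_leq_size u sub).
have round x y : x \in S -> y \in S -> y != x ->
    [/\ uniq (del y (del x S)), ~~ odd (size (del y (del x S))),
        (size (del y (del x S)))./2.-1 = m & 1 < size (del y (del x S))].
  move=> xS yS yx.
  by rewrite !size_del ?del_uniq // ?mem_del ?yx //; split=> //; lia.
have reply x y : x \in S -> y \in S -> y != x -> wins m (del y (del x S)) ->
    has (fun y => wins m (del y (del x S))) (del x S).
  by move=> xS yS yx w; apply/hasP; exists y; rewrite // mem_del yx.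
have vertex a' b' c' : triangular f a' b' c' e S ->
    [/\ a' \in S, e \in S, e != a', wins m (del e (del a' S))
      & wins m (del a' (del e S))].
  move=> tS'; have [u' sub' _ _] := tS'.
  have aS : a' \in S by apply: sub'; rewrite mem_head.
  have eS : e \in S by apply: sub'; rewrite !inE eqxx !orbT.
  have ea : e != a' by move: u'; rewrite /= !inE !negb_or (eq_sym e) => /andP[/and3P[]].
  have [g [g1 g2]] := triangular_break tS'.
  have [u1 o1 z1 s1] := round a' e aS eS ea.
  have ae : a' != e by rewrite eq_sym.
  have [u2 o2 z2 s2] := round e a' eS aS ae.
  have := matching_good u1 o1 s1 g2; have := matching_good u2 o2 s2 g1.
  by rewrite /good z1 z2.
have tS1 := triangular_rot tS; have tS2 := triangular_rot tS1.
have [aS eS ea wa wea] := vertex _ _ _ tS.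
have [bS _ eb wb _] := vertex _ _ _ tS1.
have [cS _ ec wc _] := vertex _ _ _ tS2.
apply/allP => x xS.
have [xT|xT] := boolP (x \in [:: a; b; c; e]).
  move: xT; rewrite !inE => /or4P[] /eqP->; try exact: (reply _ e).
  by apply: (reply _ a) => //; rewrite eq_sym.
(* B took a paired number: A takes its partner and the four special numbers survive. *)
have [u sub dT mS] := tS.
have xF : x \in [seq z <- S | z \notin [:: a; b; c; e]] by rewrite mem_filter xT.
have [fxF fxx ffx dx] := mS x xF.
move: (fxF); rewrite mem_filter => /andP[fxT fxS].
have [u1 o1 z1 s1] := round x (f x) xS fxS fxx.
apply: (reply _ (f x)) => //; apply: IH => //; split=> //.
  move=> z zT; rewrite !mem_del (sub z zT) andbT.
  by apply/andP; split; apply: contraTneq zT => ->.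
have := matching_del mS xF; congr matching.
rewrite /del -!filter_predI; apply: eq_filter => z /=.
by rewrite -[RHS]andbA [RHS]andbC.
Qed.

(** * First moves of A that create a pairing or a triangle *)

Lemma win_by_matching n r f : odd n -> 2 < n -> 0 < r <= n ->
  (forall x, 0 < x <= n -> x != r ->
    [/\ [/\ 0 < f x <= n, f x != r & f x != x], f (f x) = x & d %| x + f x]) ->
  has_winning_strategy n d PlayerA.
Proof.
move=> on n3 rn mf.
have rI : r \in iota 1 n by rewrite mem_iota; lia.
have sz := size_del (iota_uniq 1 n) rI; rewrite size_iota in sz.
apply: (good_first_move_wins on n3 rI); apply: (@matching_good f).
- exact/del_uniq/iota_uniq.
- by rewrite sz; lia.
- by rewrite sz; lia.
move=> x; rewrite mem_del mem_iota => /andP[xr xn].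
have [|[fn fr fx] ffx dx] := mf x _ xr; first by lia.
by split=> //; rewrite mem_del mem_iota fr; lia.
Qed.

Lemma win_by_triangle n r f a b c e : odd n ->
  uniq [:: r; a; b; c; e] -> all (fun x => 0 < x <= n) [:: r; a; b; c; e] ->
  d %| a + b -> d %| a + c -> d %| b + c ->
  (forall x, 0 < x <= n -> x \notin [:: r; a; b; c; e] ->
    [/\ [/\ 0 < f x <= n, f x \notin [:: r; a; b; c; e] & f x != x],
        f (f x) = x & d %| x + f x]) ->
  has_winning_strategy n d PlayerA.
Proof.
move=> on uT /allP rT dab dac dbc mf.
have inT x : x \in [:: r; a; b; c; e] -> x \in iota 1 n.
  by move=> /rT; rewrite mem_iota; lia.
have rI : r \in iota 1 n by apply/inT/mem_head.
have sz := size_del (iota_uniq 1 n) rI; rewrite size_iota in sz.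
have n3 : 2 < n.
  by have := uniq_leq_size uT inT; rewrite size_iota /=; lia.
move: (uT); rewrite cons_uniq => /andP[rnT uT'].
apply: (good_first_move_wins on n3 rI); apply: (@triangular_good f a b c e).
- exact/del_uniq/iota_uniq.
- by rewrite sz; lia.
split=> //.
  move=> z zT; have zI : z \in iota 1 n by apply: inT; rewrite in_cons zT orbT.
  rewrite mem_del zI andbT.
  by apply: contraNneq rnT => <-.
move=> x; rewrite mem_filter mem_del mem_iota => /and3P[xT xr xn].
have [||[fn fT fx] ffx dx] := mf x; first by lia.
  by rewrite inE negb_or xr.
split=> //; move: fT; rewrite inE negb_or => /andP[fr fT].
by rewrite mem_filter mem_del mem_iota fr fT; lia.
Qed.

End Divisor.

(** * Boards paired by the reflection x <-> M - x *)

Section Reflection.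

Variables d M : nat.
Hypothesis dM : d %| M.

Lemma dvdn_reflect x : x <= M -> d %| x + (M - x).
Proof. by move=> xM; rewrite subnKC. Qed.

(** The two sums add up to 2M. Hence M/2, t and M - t form a triangle as soon as d divides M/2 +
    t. *)
Lemma dvdn_half_reflect t : ~~ odd M -> t <= M -> d %| M./2 + t ->
  d %| M./2 + (M - t).
Proof.
move=> eM tM dt; have := dvdn_add dM dM.
have -> : M + M = M./2 + t + (M./2 + (M - t)) by lia.
by rewrite dvdn_addr.
Qed.

Lemma win_even_sub1 : ~~ odd M -> 3 < M -> has_winning_strategy (M - 1) d PlayerA.
Proof.
(* A deletes M/2, the fixed point of the reflection. *)
move=> eM M3; apply: (@win_by_matching d _ M./2 (fun x => M - x)); try lia.
move=> x xn xr; split; [split| |apply: dvdn_reflect]; lia.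
Qed.

Lemma win_odd_sub2 : odd M -> 4 < M -> has_winning_strategy (M - 2) d PlayerA.
Proof.
(* A deletes 1, whose partner M - 1 is off the board; as M is odd there is no fixed point. *)
move=> oM M4; apply: (@win_by_matching d _ 1 (fun x => M - x)); try lia.
move=> x xn xr; split; [split| |apply: dvdn_reflect]; lia.
Qed.

Lemma win_odd : odd M -> 2 < M -> has_winning_strategy M d PlayerA.
Proof.
move=> oM M2; apply: (@win_by_matching d _ M (fun x => M - x)); try lia.
move=> x xn xr; split; [split| |apply: dvdn_reflect]; lia.
Qed.

(** Without M + 1, the reflection leaves over only M and M/2, both multiples of d, so they are
    paired together. *)
Lemma win_even_add1 : ~~ odd M -> 1 < M -> d %| M./2 ->
  has_winning_strategy (M + 1) d PlayerA.
Proof.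
move=> eM M1 dh.
apply: (@win_by_matching d _ (M + 1) (fun x =>
  if x == M then M./2 else if x == M./2 then M else M - x)); try lia.
move=> x xn xr; have hM : M./2 == M = false by lia.
have [->|xM] := eqVneq x M.
  by rewrite hM eqxx; split; [split| |rewrite dvdn_add]; lia.
have [->|xh] := eqVneq x M./2.
  by rewrite eqxx; split; [split| |rewrite dvdn_add]; lia.
have -> : M - x == M = false by lia.
have -> : M - x == M./2 = false by lia.
by split; [split| |apply: dvdn_reflect]; lia.
Qed.

(** Here M/2 goes into a triangle with t and M - t, and M is the fourth number. *)
Lemma win_even_add1_triangle t : ~~ odd M -> 0 < t < M./2 -> d %| M./2 + t ->
  has_winning_strategy (M + 1) d PlayerA.
Proof.
move=> eM tM dt.
apply: (@win_by_triangle d _ (M + 1) (fun x => M - x) M./2 t (M - t) M) => //.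
- by lia.
- by rewrite /= !inE; lia.
- by rewrite /=; lia.
- by apply: dvdn_half_reflect => //; lia.
- by apply: dvdn_reflect; lia.
move=> {dt} x xn; rewrite !inE !negb_or => /and5P[x1 x2 x3 x4 x5].
by split; [split; [|apply/and5P; split|]| |apply: dvdn_reflect]; lia.
Qed.

Lemma win_even_sub3 t : ~~ odd M -> 2 < t < M./2 -> d %| M./2 + t ->
  has_winning_strategy (M - 3) d PlayerA.
Proof.
move=> eM tM dt.
(* The partners of 1 and 2 exceed M - 3: A deletes 2 and keeps 1 as the fourth number. The bound 2 <
   t keeps M - t on the board. *)
apply: (@win_by_triangle d _ 2 (fun x => M - x) M./2 t (M - t) 1) => //.
- by lia.
- by rewrite /= !inE; lia.
- by rewrite /=; lia.
- by apply: dvdn_half_reflect => //; lia.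
- by apply: dvdn_reflect; lia.
move=> {dt} x xn; rewrite !inE !negb_or => /and5P[x1 x2 x3 x4 x5].
by split; [split; [|apply/and5P; split|]| |apply: dvdn_reflect]; lia.
Qed.

Lemma win_odd_add2 : odd M -> 0 < d < M -> has_winning_strategy (M + 2) d PlayerA.
Proof.
move=> oM ltdM.
(* The triangle consists of multiples of d; d and M - d differ because M is odd. *)
apply: (@win_by_triangle d _ (M + 2) (fun x => M - x) M d (M - d) (M + 1)) => //.
- by lia.
- by rewrite /= !inE; lia.
- by rewrite /=; lia.
- by rewrite dvdn_add.
- by rewrite dvdn_add // dvdn_sub.
- by apply: dvdn_reflect; lia.
move=> x xn; rewrite !inE !negb_or => /and5P[x1 x2 x3 x4 x5].
by split; [split; [|apply/and5P; split|]| |apply: dvdn_reflect]; lia.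
Qed.

End Reflection.

(** * The families of board sizes *)

Theorem theorem3p1p10 (d k : nat) (hd : 7 <= d) (hk : 1 <= k) :
  (~~ odd d ->
     forall n : nat,
       n \in [:: k * d - 1; (k + 1) * d + 1; (k + 3) * d - 3] ->
       has_winning_strategy n d PlayerA) /\
  (odd d ->
     forall n : nat,
       n \in [:: (2 * k - 1) * d - 2; (2 * k - 1) * d; 2 * k * d - 1;
                 2 * k * d + 1; (2 * k + 1) * d + 2; 2 * (k + 1) * d - 3] ->
       has_winning_strategy n d PlayerA).
Proof.
have dmul q : d %| q * d by exact: dvdn_mull.
split=> od n; rewrite !inE.
  have emul q : ~~ odd (q * d) by rewrite oddM negb_and od orbT.
  have half_even q : ~~ odd q -> (q * d)./2 = q./2 * d.
    by move=> eq; rewrite -[q in LHS]even_halfK // -doubleMl doubleK.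
  (* For odd q, half of qd is congruent to d/2 modulo d, so t = d/2 completes a triangle. *)
  have half_odd q : odd q -> (q * d)./2 + d./2 = q./2.+1 * d.
    move=> oq; have -> : q * d = q./2.*2 * d + d.
      by rewrite -[q in LHS]odd_double_half oq mulnDl mul1n addnC.
    rewrite -doubleMl halfD odd_double doubleK /= add0n -addnA addnn even_halfK //.
    by rewrite mulSn addnC.
  case/or3P=> /eqP->.
  - by apply: win_even_sub1 => //; nia.
  - have [ok|ek] := boolP (odd (k + 1)).
      apply: (@win_even_add1_triangle _ _ _ d./2) => //; last by rewrite half_odd.
      by nia.
    by apply: win_even_add1; rewrite ?half_even //; nia.
  (* With M = (k + 3)d, M/2 is d/2 or 0 modulo d, whence t = d/2 or t = d. As d is even and at least
     7, d/2 exceeds 2. *)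
  - have [ok|ek] := boolP (odd (k + 3)).
      apply: (@win_even_sub3 _ _ _ d./2) => //; last by rewrite half_odd.
      by nia.
    by apply: (@win_even_sub3 _ _ _ d) => //; rewrite half_even // ?dvdn_addr //; nia.
have edbl q : ~~ odd (2 * q * d) by rewrite !oddM.
have half_dbl q : (2 * q * d)./2 = q * d by rewrite -mulnA mul2n doubleK.
have oddbl q : odd q -> odd (q * d) by rewrite oddM od andbT.
(* The even values of M have the form 2qd, with half qd a multiple of d, so no split on the parity
   of k is needed. *)
case/or4P=> [/eqP->|/eqP->|/eqP->|/or3P[]/eqP->].
- by apply: win_odd_sub2; rewrite ?oddbl //; nia.
- by apply: win_odd; rewrite ?oddbl //; nia.
- by apply: win_even_sub1; rewrite ?edbl //; nia.
- by apply: win_even_add1; rewrite ?edbl ?half_dbl //; nia.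
- by apply: win_odd_add2; rewrite ?oddbl //; nia.
by apply: (@win_even_sub3 _ _ _ d); rewrite ?edbl ?half_dbl ?dvdn_addr //; nia.
Qed.
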